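(* Let $G$ be a finite simple connected closed graph with $n>1$ vertices and diameter $h$. Then \[C_{\mathrm{WS}}\ge \frac13-\frac{h+1}{3n}.\]
   Context: A labeling of $G$ is a bijection $V(G)\to[n]$, identifying $V(G)=[n]$; it is closed if whenever $\{j,i\},\{i,k\}\in E(G)$ with $j\neq k$ and either $j>i<k$ or $j<i>k$, then $\{j,k\}\in E(G)$; $G$ is closed if it has a closed labeling. The local clustering coefficient of a vertex $v$ is $C_v=\frac{\#\{\text{pairs of neighbors of } v \text{ joined by an edge}\}}{\#\{\text{pairs of neighbors of } v\}}$ if $\deg(v)\ge2$, and $C_v=0$ if $\deg(v)\le1$. The Watts–Strogatz clustering coefficient is $C_{\mathrm{WS}}=\frac1n\sum_{v\in V(G)}C_v$. *)

(* Defs.v *)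
From mathcomp Require Import all_boot all_order all_algebra.
Set Implicit Arguments.
Unset Strict Implicit.
Unset Printing Implicit Defensive.
Import Order.TTheory GRing.Theory Num.Theory.

(* A finite simple graph is a symmetric irreflexive relation e on a finType T. *)
Section GraphDefs.
Variables (T : finType) (e : rel T).

Definition simple_graph : Prop := symmetric e /\ irreflexive e.

Definition connected_graph : Prop := forall x y : T, connect e x y.

(* Labels are 0, ..., n - 1 instead of 1, ..., n; only their order matters. *)
Definition labeling (f : T -> 'I_#|T|) : Prop := bijective f.

Definition closed_labeling (f : T -> 'I_#|T|) : Prop :=
  labeling f /\
  forall i j k : T, e j i -> e i k -> j != k ->
    (f j > f i /\ f i < f k) \/ (f j < f i /\ f i > f k) -> e j k.

Definition closed_graph : Prop := exists f : T -> 'I_#|T|, closed_labeling f.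

Definition walk (k : nat) (x y : T) : bool :=
  [exists p : k.-tuple T, path e x p && (last x p == y)].

(* The least length of a walk from x to y; the junk value #|T| when there is
   none (a shortest walk has fewer than #|T| edges, see gdistP below). *)
Definition gdist (x y : T) : nat := find (fun k => walk k x y) (iota 0 #|T|).

Definition diameter : nat := \max_(x : T) \max_(y : T) gdist x y.

Definition neighbors (v : T) : {set T} := [set w | e v w].

Definition degree (v : T) : nat := #|neighbors v|.

Definition neighbor_pairs (v : T) : {set {set T}} :=
  [set A : {set T} | (A \subset neighbors v) && (#|A| == 2)].

Definition linked_neighbor_pairs (v : T) : {set {set T}} :=
  [set A in neighbor_pairs v | [exists x in A, exists y in A, e x y]].

Local Open Scope ring_scope.

Definition local_clustering (v : T) : rat :=
  if (2 <= degree v)%N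
  then #|linked_neighbor_pairs v|%:R / #|neighbor_pairs v|%:R
  else 0.

Definition clustering_WS : rat :=
  #|T|%:R^-1 * \sum_(v : T) local_clustering v.

End GraphDefs.

Lemma walkP (T : finType) (e : rel T) k x y :
  reflect (exists p, [/\ size p = k, path e x p & last x p = y]) (walk e k x y).
Proof.
apply: (iffP existsP) => [[p /andP[xp /eqP lp]]|[p [sp xp lp]]].
  by exists p; rewrite size_tuple.
by move/eqP: sp => sp; exists (Tuple sp); rewrite /= xp lp eqxx.
Qed.

Lemma gdistP (T : finType) (e : rel T) x y : connect e x y ->
  walk e (gdist e x y) x y /\ (forall k, walk e k x y -> gdist e x y <= k).
Proof.
case/connectP=> p0 xp0 ->; case/shortenP: xp0 => p xp up _.
have szp : size p < #|T|.
  by have := max_card (mem (x :: p)); rewrite (card_uniqP up).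
set y' := last x p.
have hs : has (fun k => walk e k x y') (iota 0 #|T|).
  apply/hasP; exists (size p); first by rewrite mem_iota.
  by apply/walkP; exists p.
have lt : gdist e x y' < #|T| by rewrite -[X in _ < X](size_iota 0) -has_find.
split; first by have := nth_find 0 hs; rewrite nth_iota ?add0n.
move=> k wk; rewrite leqNgt; apply/negP=> ltk.
have := before_find 0 ltk; rewrite nth_iota ?add0n ?wk //.
exact: ltn_trans ltk lt.
Qed.

(* Main.v *)
Require Import Defs.
From mathcomp Require Import all_boot all_order all_algebra.
From mathcomp Require Import zify lra.
Import Order.TTheory GRing.Theory Num.Theory.
Set Implicit Arguments.
Unset Strict Implicit.
Unset Printing Implicit Defensive.

(** Fix a closed labeling and call a vertex crossed if some edge joins a smaller
    label to a larger one.  Connectedness forces every vertex lying under an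
    edge to be adjacent to both of its ends.  Hence a crossed vertex with [a]
    larger and [b] smaller neighbors has [a, b > 0], its larger (smaller)
    neighbors form a clique, and at least one edge joins the two cliques, so its
    local clustering coefficient is at least
    [('C(a, 2) + 'C(b, 2) + 1) / 'C(a + b, 2) >= 1 / 3].  A walk from the first
    to the last vertex visits every uncrossed vertex, so a geodesic shows that
    there are at most [h + 1] of those. *)

(** The relation [lt] is left arbitrary so that the reversed order can be used as well. *)
Definition ascending {T : finType} (e lt : rel T) : rel T :=
  [rel x y | e x y && lt x y].

Definition crossed {T : finType} (e : rel T) (r : T -> nat) : pred T :=
  [pred v | [exists j, exists k, [&& e j k, r j < r v & r v < r k]]].

(** Follow the ascending path back from [z]: its last vertex before [z] and [x] are both lower
    neighbors of [z], hence equal or adjacent. If [x] is the lower of the two, recurse on the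
    shortened path; otherwise the shortened path extends up to [x]. *)
Lemma ascending_extend (T : finType) (e lt : rel T) (x y z : T) :
  symmetric e ->
  (forall u v, u != v -> lt u v || lt v u) ->
  (forall u v w, e u w -> e v w -> lt u w -> lt v w -> u != v -> e u v) ->
  connect (ascending e lt) y z -> e x z -> lt x z ->
  connect (ascending e lt) x y \/ connect (ascending e lt) y x.
Proof.
move=> e_sym lt_total e_closed /connectP[p yp ->] {z}.
elim/last_ind: p yp => [_|p w IHp] /=.
  by move=> xy lt_xy; left; apply: connect1; rewrite /ascending /= xy.
rewrite rcons_path last_rcons => /andP[yp /andP[lw lt_lw]] xw lt_xw.
have up_yl : connect (ascending e lt) y (last y p) by apply/connectP; exists p.
have [->|neq] := eqVneq x (last y p); first by right.
have xl := e_closed _ _ _ xw lw lt_xw lt_lw neq.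
have /orP[lt_xl|lt_lx] := lt_total _ _ neq; first exact: IHp.
right; apply: connect_trans up_yl (connect1 _).
by rewrite /ascending /= e_sym xl lt_lx.
Qed.

Lemma connect_ascending (T : finType) (e lt : rel T) (x y : T) :
  symmetric e -> irreflexive e ->
  (forall u v, u != v -> lt u v || lt v u) ->
  (forall u v w, e u w -> e v w -> lt u w -> lt v w -> u != v -> e u v) ->
  (forall u v w, e u w -> e v w -> lt w u -> lt w v -> u != v -> e u v) ->
  connect e x y ->
  connect (ascending e lt) x y \/ connect (ascending e lt) y x.
Proof.
move=> e_sym e_irr lt_total closed_down closed_up /connectP[p xp ->] {y}.
elim: p x xp => [|z p IHp] x /=; first by left.
move=> /andP[xz /IHp{IHp}].
have /lt_total/orP[lt_xz|lt_zx] : x != z.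
  by apply: contraTneq xz => ->; rewrite e_irr.
- case=> [up|up]; last exact: ascending_extend up xz lt_xz.
  by left; apply: connect_trans up; apply: connect1; rewrite /ascending /= xz.
- case=> [up|up]; last first.
    right; apply: connect_trans up (connect1 _).
    by rewrite /ascending /= e_sym xz.
  (* The case left has [x] above [z] and an ascending path from [z] to the end of the walk. It is
     [ascending_extend] for the reversed order, with [closed_up] in the role of downward
     closedness. *)
  pose gt : rel T := [rel u v | lt v u].
  have revE :
    connect (ascending e gt) =2 fun u v => connect (ascending e lt) v u.
    move=> u v; apply: etrans (connect_rev _ u v); apply: eq_connect => s t.
    by rewrite /ascending /= e_sym.
  have := @ascending_extend T e gt x (last z p) z e_sym.
  rewrite !revE => extend; apply/or_comm; apply: extend => //.
  by move=> u v neq; rewrite /gt /= orbC lt_total.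
Qed.

Section ClosedLabeling.
Variables (T : finType) (e : rel T) (r : T -> nat).
Hypotheses (e_sym : symmetric e) (e_irr : irreflexive e).
Hypothesis e_conn : connected_graph e.
Hypothesis r_inj : injective r.
Hypothesis closed_down : forall u v w,
  e u w -> e v w -> r u < r w -> r v < r w -> u != v -> e u v.
Hypothesis closed_up : forall u v w,
  e u w -> e v w -> r w < r u -> r w < r v -> u != v -> e u v.

(** Adjacency to [k] propagates along an ascending path from [j] to [m]: the next vertex and [k] are
    both higher neighbors of the current one. Then [j] and [m] are both lower neighbors of [k],
    hence adjacent. *)
Lemma edge_interval j m k :
  e j k -> r j < r m -> r m < r k -> e j m /\ e m k.
Proof.
move=> jk jm mk; pose lt := [rel u v | r u < r v].
have leq_up u v : connect (ascending e lt) u v -> r u <= r v.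
  case/connectP=> p + ->; elim: p u => //= w p IHp u /andP[/andP[_ /= uw]] /IHp.
  by lia.
have lt_total u v : u != v -> lt u v || lt v u.
  by move=> neq; rewrite /lt /= -neq_ltn (inj_eq r_inj).
have mk_adj : e m k.
  have [|/leq_up] := connect_ascending e_sym e_irr lt_total closed_down
    closed_up (e_conn j m); last by lia.
  case/connectP=> p; elim: p j jk {jm} => [|w p IHp] j jk /=.
    by move=> _ ->.
  move=> /andP[/andP[jw /= lt_jw] wp] mE.
  have le_wm : r w <= r m by apply: leq_up; apply/connectP; exists p.
  apply: (IHp w) => //; apply: (@closed_up _ _ j); rewrite 1?e_sym //; first lia.
  by apply/eqP => wk; move: mk; rewrite -wk; lia.
split=> //; apply: (closed_down jk mk_adj _ mk); first exact: ltn_trans mk.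
by apply: contraTneq jm => ->; rewrite ltnn.
Qed.

(** A discrete intermediate value argument: an edge of the walk jumping up over [v] would make [v]
    crossed. *)
Lemma uncrossed_mem_path x p v :
  path e x p -> r x <= r v <= r (last x p) -> ~~ crossed e r v ->
  v \in x :: p.
Proof.
move=> + + /existsPn v_unc; elim: p x => [|y p IHp] x /=.
  by move=> _; rewrite -eqn_leq (inj_eq r_inj) inE eq_sym.
move=> /andP[xy yp] /andP[xv vl]; rewrite inE.
have [//|neq] := eqVneq v x; apply: IHp => //; rewrite vl andbT leqNgt.
have := v_unc x; rewrite negb_exists => /forallP/(_ y).
have : r v != r x by rewrite (inj_eq r_inj).
by rewrite xy /=; lia.
Qed.

Lemma card_uncrossed : #|[pred v | ~~ crossed e r v]| <= diameter e + 1.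
Proof.
have [T0|/card_gt0P[x0 _]] := posnP #|T|.
  by apply: leq_trans (max_card _) _; rewrite T0.
case: (@arg_minnP T x0 predT r isT) => x _ x_min.
case: (@arg_maxnP T x0 predT r isT) => y _ y_max.
have [/walkP[p [sz_p xp lastp]] _] := gdistP (e_conn x y).
have sub : [pred v | ~~ crossed e r v] \subset x :: p.
  apply/subsetP=> v v_unc; apply: uncrossed_mem_path => //.
  by rewrite lastp x_min //; apply: y_max.
apply: leq_trans (subset_leq_card sub) _; apply: leq_trans (card_size _) _.
(* A walk with [gdist x y] edges lists one more vertex than edges, whence the [+ 1]. *)
rewrite /= sz_p addn1 ltnS /diameter.
by apply: leq_trans (leq_bigmax x); exact: (leq_bigmax y).
Qed.

Let above v : {set T} := [set w in neighbors e v | r v < r w].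
Let below v : {set T} := [set w in neighbors e v | r w < r v].

Lemma degree_split v : degree e v = #|above v| + #|below v|.
Proof.
rewrite /degree -(cardsID (above v) (neighbors e v)); congr (_ + _).
  by apply: eq_card => w; rewrite !inE; case: (e v w).
apply: eq_card => w; rewrite !inE andbC; case vw: (e v w) => //=.
have : r v != r w.
  by rewrite (inj_eq r_inj); apply: contraTneq vw => ->; rewrite e_irr.
by lia.
Qed.

Lemma linked_pair v (A : {set T}) a b :
  A \in neighbor_pairs e v -> a \in A -> b \in A -> e a b ->
  A \in linked_neighbor_pairs e v.
Proof.
move=> Av aA bA ab; rewrite inE Av /=.
by apply/existsP; exists a; rewrite aA; apply/existsP; exists b; rewrite bA.
Qed.

Lemma clique_linked v (B : {set T}) :
  B \subset neighbors e v -> {in B &, forall x y, x != y -> e x y} ->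
  [set A : {set T} | A \subset B & #|A| == 2] \subset linked_neighbor_pairs e v.
Proof.
move=> Bv clique; apply/subsetP=> A; rewrite inE => /andP[AB A2].
have /cards2P[x [y [neq AE]]] := A2.
have [xA yA] : x \in A /\ y \in A by rewrite AE !inE !eqxx orbT.
apply: (@linked_pair v A x y) => //; first by rewrite inE (subset_trans AB).
by apply: clique => //; apply: (subsetP AB).
Qed.

(** The pairs inside [above v], those inside [below v] and the pair of ends of an edge over [v] are
    all distinct; the last one gives the [+ 1]. *)
Lemma card_linked v : crossed e r v ->
  'C(#|above v|, 2) + 'C(#|below v|, 2) + 1 <= #|linked_neighbor_pairs e v|.
Proof.
case/existsP=> j /existsP[k /and3P[jk jv vk]].
have [e_jv e_vk] := edge_interval jk jv vk.
pose PU := [set A : {set T} | A \subset above v & #|A| == 2].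
pose PD := [set A : {set T} | A \subset below v & #|A| == 2].
pose J := [set j; k].
have jJ : j \in J by rewrite !inE eqxx.
have kJ : k \in J by rewrite !inE eqxx orbT.
have PU_linked : PU \subset linked_neighbor_pairs e v.
  apply: clique_linked; first by apply/subsetP=> w; rewrite inE => /andP[].
  move=> x y; rewrite !inE => /andP[vx lt_vx] /andP[vy lt_vy] neq.
  by apply: (@closed_up _ _ v); rewrite // e_sym.
have PD_linked : PD \subset linked_neighbor_pairs e v.
  apply: clique_linked; first by apply/subsetP=> w; rewrite inE => /andP[].
  move=> x y; rewrite !inE => /andP[vx lt_vx] /andP[vy lt_vy] neq.
  by apply: (@closed_down _ _ v); rewrite // e_sym.
have J_linked : J \in linked_neighbor_pairs e v.
  apply: (@linked_pair v J j k) => //.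
  rewrite inE cards2 -(inj_eq r_inj) neq_ltn (ltn_trans jv vk) andbT.
  by apply/subsetP=> w; rewrite !inE => /orP[]/eqP-> //; rewrite e_sym.
have J_notin : J \notin PU :|: PD.
  rewrite !inE; apply/negP => /orP[]/andP[/subsetP sub _].
    by have := sub j jJ; rewrite !inE => /andP[_]; lia.
  by have := sub k kJ; rewrite !inE => /andP[_]; lia.
have disj : PU :&: PD = set0.
  apply/setP=> A; rewrite !inE; apply/negP.
  move=> /andP[/andP[/subsetP AU /eqP A2] /andP[/subsetP AD _]].
  have /card_gt0P[w wA] : 0 < #|A| by rewrite A2.
  by have := AU w wA; have := AD w wA; rewrite !inE; lia.
rewrite -!cards_draws -/PU -/PD.
have <- : #|J |: (PU :|: PD)| = #|PU| + #|PD| + 1.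
  by rewrite cardsU1 J_notin cardsU disj cards0 subn0 addnC.
by apply: subset_leq_card; rewrite !subUset sub1set J_linked PU_linked.
Qed.

(** Twice the difference of the two sides is [(a - b)^2 + (a - 1)^2 + (b - 1)^2 + 4], computed over
    the integers. *)
Lemma bin2_sum_bound a b : 'C(a + b, 2) <= 3 * ('C(a, 2) + 'C(b, 2) + 1).
Proof.
have bin2E m : 'C(m, 2) * 2 = m * (m - 1).
  rewrite bin2 muln2 -[RHS]odd_double_half subn1 oddM.
  by case: m => //= m; case: odd.
rewrite -(@leq_pmul2r 2) // -mulnA !mulnDl !bin2E.
(* Splitting off zero removes the truncated subtractions. *)
by case: a b => [|a] [|b]; rewrite ?subn1 /=; nia.
Qed.

Lemma local_clustering_ge0 v : (0 <= local_clustering e v)%R.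
Proof.
by rewrite /local_clustering; case: ifP => // _; rewrite divr_ge0 ?ler0n.
Qed.

Lemma crossed_clustering v :
  crossed e r v -> (1 / 3 <= local_clustering e v)%R.
Proof.
move=> v_cr; have := card_linked v_cr.
have card_pairs : #|neighbor_pairs e v| = 'C(degree e v, 2).
  by rewrite /neighbor_pairs cards_draws.
(* One neighbor on each side of [v] rules out the default value [0] of [local_clustering]. *)
have deg2 : 1 < degree e v.
  case/existsP: v_cr => j /existsP[k /and3P[jk jv vk]].
  have [e_jv e_vk] := edge_interval jk jv vk.
  rewrite degree_split -[2]/(1 + 1); apply: leq_add; apply/card_gt0P.
    by exists k; rewrite !inE e_vk.
  by exists j; rewrite !inE e_sym e_jv.
have := bin2_sum_bound #|above v| #|below v|; rewrite -degree_split -card_pairs.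
move=> pairs_le linked_ge; rewrite /local_clustering deg2.
have pairs_gt0 : (0 < #|neighbor_pairs e v|%:R :> rat)%R.
  by rewrite ltr0n card_pairs bin_gt0.
have :
  (#|neighbor_pairs e v|%:R <= 3 * #|linked_neighbor_pairs e v|%:R :> rat)%R.
  by rewrite -natrM ler_nat; lia.
by rewrite ler_pdivlMr //; lra.
Qed.

Lemma closed_clustering_bound : 1 < #|T| ->
  (1 / 3 - (diameter e + 1)%:R / (3 * #|T|%:R) <= clustering_WS e)%R.
Proof.
move=> T_gt1; have n_gt0 : (0 < #|T|%:R :> rat)%R by rewrite ltr0n; lia.
have sum_ge : (#|crossed e r|%:R / 3 <= \sum_v local_clustering e v)%R.
  rewrite (bigID (crossed e r)) /= -[leLHS]addr0 lerD //; last first.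
    by apply: sumr_ge0 => v _; apply: local_clustering_ge0.
  have -> : (#|crossed e r|%:R / 3 = \sum_(v | crossed e r v) (1 / 3) :> rat)%R.
    by rewrite sumr_const div1r mulr_natl.
  by apply: ler_sum => v; apply: crossed_clustering.
have card_le : (#|T|%:R <= #|crossed e r|%:R + (diameter e + 1)%:R :> rat)%R.
  rewrite -natrD ler_nat -(cardC (crossed e r)) leq_add2l.
  exact: card_uncrossed.
(* Multiplied by [#|T|], the claim bounds the sum below by a third of [#|T| - (diameter e + 1)]. *)
rewrite /clustering_WS [leRHS]mulrC ler_pdivlMr // mulrBl.
rewrite invfM mulrA mulfVK ?gt_eqF //.
by lra.
Qed.

End ClosedLabeling.

Theorem theorem6p3 (T : finType) (e : rel T) (n h : nat)
  (e_simple : simple_graph e)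
  (e_conn : connected_graph e)
  (e_closed : closed_graph e)
  (n_def : #|T| = n)
  (n_gt1 : 1 < n)
  (h_def : diameter e = h) :
  (1 / 3 - (h + 1)%:R / (3 * n%:R) <= clustering_WS e)%R.
Proof.
case: e_simple e_closed => e_sym e_irr [f [f_bij f_closed]].
subst n h; apply: (@closed_clustering_bound T e (fun v => f v : nat)) => //.
- by move=> x y /val_inj/(bij_inj f_bij).
(* The common neighbor [w] is the middle vertex [i] of [closed_labeling]. *)
- move=> u v w uw vw ltu ltv neq.
  by apply: (f_closed w) => //; [rewrite e_sym | right].
- move=> u v w uw vw ltu ltv neq.
  by apply: (f_closed w) => //; [rewrite e_sym | left].
Qed.
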